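(* Let $K$ be a countable infinite field, let $(A_x)_{x\in K}$ and $(M_y)_{y\in K^*}$ be unitary representations, respectively, of the additive group $(K,+)$ and the multiplicative group $(K^*,\times)$ on the same Hilbert space $H$, satisfying the distributivity law $$M_yA_x=A_{xy}M_y\qquad\forall x,y\in K,\ y\neq0.$$ Then for every sequence $(F_N)_{N\in\mathbb{N}}$ of finite subsets of $K^*$ which is simultaneously a Følner sequence for both $(K,+)$ and $(K^*,\times)$, and for every $f\in H$, we have $$\lim_{N\to\infty}\frac1{|F_N|}\sum_{x\in F_N}M_xA_xf=Pf$$ (in the norm of $H$), where $P$ is the orthogonal projection onto the invariant subspace $\{h\in H:A_xh=M_yh=h\ \ \forall x,y\in K,\ y\neq0\}$.
   Context: $K^*=K\setminus\{0\}$. A sequence $(F_N)$ of non-empty finite subsets of $K^*$ is simultaneously a Følner sequence for $(K,+)$ and $(K^*,\times)$ if $|(x+F_N)\cap F_N|/|F_N|\to1$ for every $x\in K$ and $|(yF_N)\cap F_N|/|F_N|\to1$ for every $y\in K^*$. *)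

(* Defs.v *)
From HB Require Import structures.
From mathcomp Require Import all_boot all_order all_algebra.
From mathcomp Require Import finmap complex.
From mathcomp Require Import all_classical all_reals all_analysis.

Set Implicit Arguments.
Unset Strict Implicit.
Unset Printing Implicit Defensive.

Import Order.TTheory GRing.Theory Num.Theory.
Import numFieldNormedType.Exports.

Local Open Scope classical_set_scope.
Local Open Scope ring_scope.

(* A complex Hilbert space is a complete normed module over R[i] together with
   an inner product (linear in the first argument, conjugate-linear in the
   second) which induces the norm. *)
Definition hilbert_dot (R : realType) (H : completeNormedModType R[i])
    (dot : {dot H for Num.conj}) : Prop :=
  forall h : H, `|h| ^+ 2 = dot h h.

Definition unitary (R : realType) (H : completeNormedModType R[i])
    (dot : {dot H for Num.conj}) (U : {linear H -> H}) : Prop :=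
  bijective U /\ isometry dot dot U.

(* The group is the set D with the operation op, inside an ambient type G, so
   that the multiplicative group of a field K is [set x | x != 0] with the
   product of K; the operators U g with g outside D are arbitrary. *)
Definition unitary_representation (R : realType)
    (H : completeNormedModType R[i]) (dot : {dot H for Num.conj})
    (G : Type) (D : set G) (op : G -> G -> G)
    (U : G -> {linear H -> H}) : Prop :=
  (forall g, D g -> unitary dot (U g)) /\
  (forall g g', D g -> D g' -> forall h, U (op g g') h = U g (U g' h)).

Definition folner (R : realType) (G : choiceType) (D : set G)
    (op : G -> G -> G) (F : nat -> {fset G}) : Prop :=
  forall g, D g ->
    (#|` ([fset op g z | z in F N] `&` F N)%fset |%:R / #|` F N|%:R : R)
      @[N --> \oo] --> (1 : R).

(* Simultaneously Folner for the additive and the multiplicative group. *)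
Definition double_folner (R : realType) (K : fieldType)
    (F : nat -> {fset K}) : Prop :=
  [/\ forall N, F N != fset0,
      forall N, 0 \notin F N,
      folner R [set: K] +%R F
    & folner R [set y : K | y != 0] *%R F].

Definition invariant_subspace (R : realType) (H : completeNormedModType R[i])
    (K : fieldType) (A M : K -> {linear H -> H}) : set H :=
  [set h | forall x y : K, y != 0 -> A x h = h /\ M y h = h].

Definition orthogonal_projection (R : realType)
    (H : completeNormedModType R[i]) (dot : {dot H for Num.conj})
    (V : set H) (P : {linear H -> H}) : Prop :=
  forall h, V (P h) /\ (forall v, V v -> dot (h - P h) v = 0).

(* Main.v *)
Require Import Defs.
From HB Require Import structures.
From mathcomp Require Import all_boot all_order all_algebra.
From mathcomp Require Import finmap complex.
From mathcomp Require Import all_classical all_reals all_analysis.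
From mathcomp Require Import ring lra.

Set Implicit Arguments.
Unset Strict Implicit.
Unset Printing Implicit Defensive.

Import Order.TTheory GRing.Theory Num.Theory.
Import numFieldNormedType.Exports.

Local Open Scope classical_set_scope.
Local Open Scope ring_scope.

(** Let V_A and V_M be the spaces of vectors fixed by all A_x, respectively by
    all M_y. Split f into its projection g on V_A and the rest f - g, which is
    orthogonal to V_A; the two parts average for different reasons.

    On the rest, put u(x) = M_x A_x (f - g). The distributivity law turns the
    correlation <u(bx), u(b'x)> into
      <A_{x (b^2 - b'^2)} M_b (f - g), M_b' (f - g)>
    ([orbit_correlation]). The law also makes V_A stable under each M_b, and so
    is its orthogonal complement. As soon as b^2 and b'^2 differ, the mean
    ergodic theorem for the representation x |-> A_{x (b^2 - b'^2)}, whose fixed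
    space is again V_A, makes the mean of the correlation over F_N tend to 0
    ([dilated_mean_ergodic]). A van der Corput argument ([van_der_corput])
    concludes: because F_N is multiplicatively Folner, the average of u is
    asymptotically the average of u(b .), for each b in a finite set B and
    hence also on average over B; in the square of that norm only the
    diagonal terms survive, and they contribute O(1/|B|). An infinite field
    has arbitrarily large B with pairwise distinct squares.

    On g the operators A_x act trivially and the average is that of M_x g. The
    projection on V_A commutes with each M_y, hence preserves V_M
    ([projection_fixed]); therefore g - P f is orthogonal to all of V_M, and the
    mean ergodic theorem for M sends the average to P f.

    The mean ergodic theorem is proved by projecting on the closed space of the
    vectors whose averages tend to 0. It contains every U_g h - h, so a vector
    orthogonal to it is fixed ([mean_ergodic]). Orthogonal projections on closed
    subspaces are obtained from nearest points ([nearest_point]).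

    All estimates are made in R: the complex inner product is replaced by its
    real part, which determines orthogonality to complex subspaces
    ([dot0_rdot]). *)

(** * The underlying real inner product *)

Section RealInnerProduct.
Context {R : realType} {H : completeNormedModType R[i]}.
Variable dot : {dot H for Num.conj}.
Hypothesis dot_norm : hilbert_dot dot.

Definition rnorm (u : H) : R := complex.Re `|u|.

Definition rdot (u v : H) : R := complex.Re (dot u v).

Lemma rnormE u : `|u| = (rnorm u)%:C%C.
Proof. by rewrite /rnorm RRe_real //; exact: normr_real. Qed.

Lemma rnorm_ge0 u : 0 <= rnorm u.
Proof. by rewrite -lecR -rnormE; exact: normr_ge0. Qed.

Lemma rnorm0 : rnorm 0 = 0.
Proof. by rewrite /rnorm normr0. Qed.

Lemma rnorm_eq0 u : rnorm u = 0 -> u = 0.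
Proof. by move=> u0; apply/eqP; rewrite -normr_eq0 rnormE u0. Qed.

Lemma ler_rnormD u v : rnorm (u + v) <= rnorm u + rnorm v.
Proof. by rewrite -lecR rmorphD /= -!rnormE ler_normD. Qed.

Lemma rnormN u : rnorm (- u) = rnorm u.
Proof. by rewrite /rnorm normrN. Qed.

Lemma ler_rnormB u v : rnorm (u - v) <= rnorm u + rnorm v.
Proof. by rewrite (le_trans (ler_rnormD _ _)) ?rnormN. Qed.

Lemma rnormZ (r : R) u : rnorm (r%:C%C *: u) = `|r| * rnorm u.
Proof.
apply: complexI; rewrite -rnormE normrZ rmorphM /= -rnormE; congr (_ * _).
by rewrite normc_def /= expr0n addr0 sqrtr_sqr.
Qed.

Lemma ler_rnorm_sum I (s : seq I) (u : I -> H) :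
  rnorm (\sum_(i <- s) u i) <= \sum_(i <- s) rnorm (u i).
Proof.
elim/big_ind2: _ => [|x a y b xa yb|//]; first by rewrite rnorm0.
exact: le_trans (ler_rnormD _ _) (lerD _ _).
Qed.

Lemma cvg_rnormP (T : Type) (F : set_system T) (FF : Filter F) (u : T -> H) l :
  u @ F --> l <-> (fun t => rnorm (u t - l)) @ F --> (0 : R).
Proof.
split=> [/cvgrPdist_lt ul|/cvgrPdist_lt ul]; apply/cvgrPdist_lt => e e0.
  have e0C : 0 < e%:C%C by rewrite ltcR.
  apply: filterS (ul _ e0C) => t; rewrite distrC rnormE ltcR sub0r normrN.
  by rewrite ger0_norm // rnorm_ge0.
have eR : e = (complex.Re e)%:C%C by rewrite RRe_real // gtr0_real.
have e0R : 0 < complex.Re e by rewrite -ltcR -eR.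
apply: filterS (ul _ e0R) => t; rewrite sub0r normrN ger0_norm ?rnorm_ge0 //.
by rewrite distrC rnormE {2}eR ltcR.
Qed.

Lemma cvg0_rnormP (T : Type) (F : set_system T) (FF : Filter F) (u : T -> H) :
  u @ F --> (0 : H) <-> (fun t => rnorm (u t)) @ F --> (0 : R).
Proof.
have := cvg_rnormP FF u 0.
by under [X in X @ _ --> (0 : R)]eq_fun do rewrite subr0.
Qed.

Lemma closed_rnorm (V : set H) :
  (forall h, (forall e : R, 0 < e -> exists2 v, V v & rnorm (h - v) < e) ->
    V h) -> closed V.
Proof.
move=> VP h hV; apply: VP => e e0.
have e0C : 0 < e%:C%C by rewrite ltcR.
have [v [Vv]] := hV _ (nbhsx_ballx h _ e0C).
by rewrite -ball_normE /= rnormE ltcR => hv; exists v.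
Qed.

Lemma rnorm_sqr u : rnorm u ^+ 2 = rdot u u.
Proof.
apply: complexI; rewrite rmorphXn /= -rnormE dot_norm /rdot.
by rewrite RRe_real -?dot_norm.
Qed.

Lemma rdotDl u v w : rdot (u + v) w = rdot u w + rdot v w.
Proof. by rewrite /rdot linearDl raddfD. Qed.

Lemma rdotDr u v w : rdot u (v + w) = rdot u v + rdot u w.
Proof. by rewrite /rdot linearDr raddfD. Qed.

Lemma rdotC u v : rdot u v = rdot v u.
Proof.
by apply: complexI; rewrite /rdot hermC expr0 mul1r !complexRe Re_conj.
Qed.

Lemma rdotZl (r : R) u v : rdot (r%:C%C *: u) v = r * rdot u v.
Proof.
rewrite /rdot linearZl_LR /=; case: (dot u v) => a b /=.
by rewrite mul0r subr0.
Qed.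

Lemma rdotZr (r : R) u v : rdot u (r%:C%C *: v) = r * rdot u v.
Proof. by rewrite rdotC rdotZl rdotC. Qed.

Lemma rdotNl u v : rdot (- u) v = - rdot u v.
Proof. by rewrite /rdot linearNl raddfN. Qed.

Lemma rdotNr u v : rdot u (- v) = - rdot u v.
Proof. by rewrite /rdot linearNr raddfN. Qed.

Lemma rdot0l u : rdot 0 u = 0.
Proof. by rewrite /rdot linear0l. Qed.

Lemma rdot_suml I (s : seq I) (u : I -> H) v :
  rdot (\sum_(i <- s) u i) v = \sum_(i <- s) rdot (u i) v.
Proof.
elim/big_ind2: _ => [|x a y b xa yb|//]; first exact: rdot0l.
by rewrite rdotDl xa yb.
Qed.

Lemma rdot_sumr I (s : seq I) (u : I -> H) v :
  rdot v (\sum_(i <- s) u i) = \sum_(i <- s) rdot v (u i).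
Proof. by rewrite rdotC rdot_suml; apply: eq_bigr => i _; rewrite rdotC. Qed.

Lemma rnormD_sqr u v :
  rnorm (u + v) ^+ 2 = rnorm u ^+ 2 + 2 * rdot u v + rnorm v ^+ 2.
Proof. by rewrite !rnorm_sqr rdotDl !rdotDr (rdotC v u); ring. Qed.

Lemma rnormB_sqr u v :
  rnorm (u - v) ^+ 2 = rnorm u ^+ 2 - 2 * rdot u v + rnorm v ^+ 2.
Proof. by rewrite rnormD_sqr rdotNr rnormN mulrN. Qed.

(** The Cauchy-Schwarz inequality follows from the triangle inequality, which
    the norm of [H] satisfies by assumption. *)
Lemma rdot_le u v : rdot u v <= rnorm u * rnorm v.
Proof.
have : rnorm (u + v) ^+ 2 <= (rnorm u + rnorm v) ^+ 2.
  by rewrite lerXn2r ?nnegrE ?addr_ge0 ?rnorm_ge0 ?ler_rnormD.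
rewrite rnormD_sqr; lra.
Qed.

Lemma parallelogram u v :
  rnorm (u + v) ^+ 2 + rnorm (u - v) ^+ 2 =
  2 * rnorm u ^+ 2 + 2 * rnorm v ^+ 2.
Proof. by rewrite rnormD_sqr rnormB_sqr; ring. Qed.

(** The imaginary part of [dot h v] is, up to sign, the real part of
    [dot h ('i *: v)]. *)
Lemma dot0_rdot (V : set H) h : (forall a v, V v -> V (a *: v)) ->
  (forall v, V v -> rdot h v = 0) -> forall v, V v -> dot h v = 0.
Proof.
move=> VZ hV v Vv; have := hV _ Vv; have := hV _ (VZ 'i%C _ Vv).
rewrite /rdot linearZr_LR /=; case: (dot h v) => a b /=.
by rewrite mul0r mulN1r opprK add0r => -> ->.
Qed.

Lemma cvg0_rdot (w : nat -> H) k : w @ \oo --> (0 : H) ->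
  (fun N => rdot (w N) k) @ \oo --> (0 : R).
Proof.
move=> /cvg0_rnormP w0.
have wk0 : (fun N => rnorm (w N) * rnorm k) @ \oo --> (0 : R).
  by rewrite -[X in _ --> X](mul0r (rnorm k)); apply: cvgM => //; exact: cvg_cst.
have wk0N : (fun N => - (rnorm (w N) * rnorm k)) @ \oo --> (0 : R).
  by rewrite -[X in _ --> X]oppr0; exact: cvgN.
apply: squeeze_cvgr wk0N wk0; apply: nearW => N.
by rewrite rdot_le // andbT lerNl -rdotNl -(rnormN (w N)) rdot_le.
Qed.

Lemma unitary_rdot (U : {linear H -> H}) u v :
  unitary dot U -> rdot (U u) (U v) = rdot u v.
Proof. by move=> [_ Uiso]; rewrite /rdot Uiso. Qed.

Lemma unitary_rnorm (U : {linear H -> H}) u :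
  unitary dot U -> rnorm (U u) = rnorm u.
Proof.
move=> Uu; apply/eqP; rewrite -(eqrXn2 (n := 2)) ?rnorm_ge0 //.
by rewrite !rnorm_sqr unitary_rdot.
Qed.
End RealInnerProduct.

(** * Orthogonal projection on a closed subspace *)

Section Projection.
Context {R : realType} {H : completeNormedModType R[i]}.
Variable dot : {dot H for Num.conj}.
Hypothesis dot_norm : hilbert_dot dot.

Definition subspace (V : set H) : Prop :=
  V 0 /\ forall (a : R[i]) u v, V u -> V v -> V (a *: u + v).

Lemma subspaceD V u v : subspace V -> V u -> V v -> V (u + v).
Proof. by move=> [_ VP] Vu Vv; rewrite -[u]scale1r; exact: VP. Qed.

Lemma subspaceZ V a u : subspace V -> V u -> V (a *: u).
Proof. by move=> [V0 VP] Vu; rewrite -[_ *: _]addr0; exact: VP. Qed.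

Lemma subspaceB V u v : subspace V -> V u -> V v -> V (u - v).
Proof.
move=> sV Vu Vv; apply: subspaceD => //.
by rewrite -scaleN1r; exact: subspaceZ.
Qed.

(** A minimising sequence for the distance from [h] to [V] is Cauchy by the
    parallelogram law, since the midpoint of two of its terms is again in [V]
    and so not nearer to [h] than the infimum. *)
Lemma nearest_point (V : set H) h : closed V -> subspace V ->
  exists2 p, V p & forall v, V v -> rnorm (h - p) <= rnorm (h - v).
Proof.
move=> cV sV; have [V0 _] := sV.
pose S := [set rnorm (h - v) ^+ 2 | v in V].
have S_ge0 : lbound S 0 by move=> _ [v _ <-]; exact: sqr_ge0.
have hS : has_inf S by split; [exists (rnorm (h - 0) ^+ 2), 0|exists 0].
have dS v : V v -> inf S <= rnorm (h - v) ^+ 2.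
  by move=> Vv; apply: ge_inf; [exact: hS.2|exists v].
have /choice[v_ v_P] n : exists v, V v /\
    rnorm (h - v) ^+ 2 < inf S + n.+1%:R^-1.
  have n0 : 0 < n.+1%:R^-1 :> R by rewrite invr_gt0 ltr0n.
  by have [_ [v Vv <-] vn] := inf_adherent n0 hS; exists v.
have v_cauchy n m :
    rnorm (v_ n - v_ m) ^+ 2 <= 2 * (n.+1%:R^-1 + m.+1%:R^-1).
  have [Vn dn] := v_P n; have [Vm dm] := v_P m.
  have := dS (2^-1 *: (v_ n + v_ m)) (subspaceZ 2^-1 sV (subspaceD sV Vn Vm)).
  have := parallelogram dot_norm (h - v_ n) (h - v_ m).
  have -> : h - v_ n - (h - v_ m) = - (v_ n - v_ m).
    by rewrite !opprB addrC subrKA.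
  have -> : h - v_ n + (h - v_ m) =
      (2 : R)%:C%C *: (h - 2^-1 *: (v_ n + v_ m)).
    rewrite rmorph_nat scalerBr scalerA mulfV ?pnatr_eq0// scale1r.
    by rewrite scaler_nat mulr2n opprD addrACA.
  rewrite rnormZ rnormN exprMn ger0_norm // => pl dm2.
  move: dn dm; set a := _^-1; set b := _^-1 => dn dm; lra.
have v_cvg : cvg (v_ @ \oo).
  apply/cauchy_cvgP/cauchy_exP => e e0.
  have eR : e = (complex.Re e)%:C%C by rewrite RRe_real // gtr0_real.
  have e0R : 0 < complex.Re e by rewrite -ltcR -eR.
  have e4 : 0 < complex.Re e ^+ 2 / 4 by rewrite divr_gt0 ?exprn_gt0.
  have [N _ NP] := near_infty_natSinv_lt (PosNum e4).
  exists (v_ N), N => // n /= Nn; rewrite -ball_normE /= rnormE eR ltcR.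
  rewrite -(ltr_pXn2r (n := 2)) ?nnegrE ?rnorm_ge0 ?ltW //.
  have := v_cauchy N n; have := NP N (leqnn N); have := NP n Nn => /=.
  set a := n.+1%:R^-1; set b := N.+1%:R^-1 => ae be ab; lra.
exists (lim (v_ @ \oo)).
  by apply: (closed_cvg V) v_cvg => //; apply: nearW => n; have [] := v_P n.
move=> v Vv; apply/ler_addgt0Pr => e e0.
have /cvg_rnormP/cvgrPdist_lt v_lim := v_cvg.
have e2 : 0 < e / 2 by rewrite divr_gt0.
have e4 : 0 < (e / 2) ^+ 2 by rewrite exprn_gt0.
have [n [/= ln vn]] := filter_ex (filterI (v_lim _ e2)
   (near_infty_natSinv_lt (PosNum e4))).
move: ln; rewrite sub0r normrN ger0_norm ?rnorm_ge0 // => ln.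
have [_ dn] := v_P n.
have hvn : rnorm (h - v_ n) <= rnorm (h - v) + e / 2.
  have b0 := rnorm_ge0 (h - v).
  rewrite -(ler_pXn2r (n := 2)) ?nnegrE ?rnorm_ge0 ?addr_ge0 // ?(ltW e2) //.
  have := dS v Vv.
  move: vn dn; set a := n.+1%:R^-1 => vn dn; nra.
have := ler_rnormD (h - v_ n) (v_ n - lim (v_ @ \oo)).
rewrite subrKA; lra.
Qed.

(** Moving [p] along a vector of [V] that is not orthogonal to [h - p] would
    bring it nearer to [h]. *)
Lemma nearest_point_orthogonal (V : set H) h p : subspace V -> V p ->
  (forall v, V v -> rnorm (h - p) <= rnorm (h - v)) ->
  forall v, V v -> dot (h - p) v = 0.
Proof.
move=> sV Vp p_near; apply: dot0_rdot => [a v Vv|v Vv]; first exact: subspaceZ.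
set c := rdot _ _ _; pose q := rnorm v ^+ 2.
have q0 : 0 <= q by exact: sqr_ge0.
(* t nearly minimises t |-> |h - p - t v|^2, whose minimum is at c / q; the
   extra 1 in the denominator covers v = 0 *)
pose t := c / (q + 1).
have ct : c = t * (q + 1) by rewrite /t divfK // gt_eqF // ltr_wpDl.
have := p_near _ (subspaceD sV Vp (subspaceZ t%:C%C sV Vv)).
rewrite -(ler_pXn2r (n := 2)) ?nnegrE ?rnorm_ge0 // opprD addrA.
rewrite (rnormB_sqr dot_norm (h - p)) rdotZr rnormZ exprMn -/c -/q.
rewrite real_normK ?num_real // ct => t_opt.
have : t ^+ 2 * (q + 2) <= 0 by nra.
rewrite pmulr_lle0 ?ltr_wpDl //.
move=> t0; suff -> : t = 0 by rewrite mul0r.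
by apply/eqP; rewrite -sqrf_eq0 eq_le t0 sqr_ge0.
Qed.

Lemma projection_unique (V : set H) h p p' : subspace V ->
  V p -> V p' -> (forall v, V v -> dot (h - p) v = 0) ->
  (forall v, V v -> dot (h - p') v = 0) -> p = p'.
Proof.
move=> sV Vp Vp' hp hp'; have Vw := subspaceB sV Vp Vp'.
apply/eqP; rewrite -subr_eq0 -(dnorm_eq0 dot).
have {1}-> : p - p' = (h - p') - (h - p) by rewrite opprB [RHS]addrC subrKA.
by rewrite linearBl /= hp // hp' // subr0.
Qed.

(** Linearity of the projection comes from its uniqueness. *)
Lemma orthogonal_projection_exists (V : set H) : closed V -> subspace V ->
  exists P : {linear H -> H}, orthogonal_projection dot V P.
Proof.
move=> cV sV.
have /choice[P PP] h : exists p, V p /\ forall v, V v -> dot (h - p) v = 0.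
  have [p Vp p_near] := nearest_point h cV sV.
  by exists p; split=> //; exact: nearest_point_orthogonal.
have Plin : linear P.
  move=> a u v; have [Vu Pu] := PP u; have [Vv Pv] := PP v.
  have [Vw Pw] := PP (a *: u + v).
  apply: (projection_unique sV Vw _ Pw); first exact: sV.2.
  move=> w Vw'; rewrite opprD addrACA -scalerBr.
  by rewrite linearDl /= linearZl_LR /= Pu // Pv // mulr0 addr0.
pose PL := GRing.isLinear.Build R[i] H H *:%R P Plin.
by exists (HB.pack_for {linear H -> H} P PL).
Qed.
End Projection.

Section Fixed.
Context {R : realType} {H : completeNormedModType R[i]} {G : Type}.
Variable dot : {dot H for Num.conj}.
Hypothesis dot_norm : hilbert_dot dot.
Variables (D : set G) (U : G -> {linear H -> H}).
Hypothesis U_unitary : forall g, D g -> unitary dot (U g).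

Definition fixed_space : set H := [set h | forall g, D g -> U g h = h].

Lemma fixed_space_subspace : subspace fixed_space.
Proof.
split=> [g _|a u v Uu Uv g Dg]; first exact: linear0.
by rewrite linearP Uu // Uv.
Qed.

Lemma fixed_space_closed : closed fixed_space.
Proof.
apply: closed_rnorm => h h_approx g Dg; apply/eqP; rewrite -subr_eq0.
apply/eqP/rnorm_eq0/eqP; rewrite eq_le rnorm_ge0 andbT.
apply/ler_addgt0Pr => e e0; rewrite add0r.
have e2 : 0 < e / 2 by rewrite divr_gt0.
have [v Uv hv] := h_approx _ e2.
have -> : U g h - h = U g (h - v) - (h - v).
  by rewrite linearB Uv // opprB addrA subrK.
apply: le_trans (ler_rnormB _ _) _.
rewrite (unitary_rnorm dot_norm _ (U_unitary Dg)) (splitr e).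
by apply: lerD; exact: ltW.
Qed.
End Fixed.

(** * Averages over finite sets *)

Section Averages.
Context {R : realType} {H : completeNormedModType R[i]} {G : choiceType}.
Implicit Types (E B : {fset G}) (u v : G -> H) (c : G -> R).

Definition avg E u : H := #|` E|%:R^-1 *: \sum_(x <- E) u x.

Definition mean E c : R := #|` E|%:R^-1 * \sum_(x <- E) c x.

Lemma sum_fset_cst (V : nmodType) E (a : V) : \sum_(x <- E) a = a *+ #|` E|.
Proof. by rewrite big_const_seq count_predT iter_addr addr0. Qed.

Lemma sum_fset_le E c C : (forall x, x \in E -> c x <= C) ->
  \sum_(x <- E) c x <= C * #|` E|%:R.
Proof.
move=> cC; rewrite mulr_natr -sum_fset_cst !big_seq; exact: ler_sum.
Qed.

Lemma mean_le E c C : E != fset0 ->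
  (forall x, x \in E -> c x <= C) -> mean E c <= C.
Proof.
move=> E0 cC; rewrite /mean ler_pdivrMl ?ltr0n ?cardfs_gt0 // mulrC.
exact: sum_fset_le.
Qed.

Lemma eq_avg E u v : {in E, u =1 v} -> avg E u = avg E v.
Proof. by move=> uv; congr (_ *: _); exact: eq_big_seq. Qed.

Lemma avgD E u v : avg E (fun x => u x + v x) = avg E u + avg E v.
Proof. by rewrite /avg big_split scalerDr. Qed.

Lemma avgZ E a u : avg E (fun x => a *: u x) = a *: avg E u.
Proof. by rewrite /avg -scaler_sumr !scalerA mulrC. Qed.

Lemma avgB E u v : avg E (fun x => u x - v x) = avg E u - avg E v.
Proof. by rewrite /avg sumrB scalerBr. Qed.

Lemma avg_cst E (h : H) : E != fset0 -> avg E (fun=> h) = h.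
Proof.
move=> E0; rewrite /avg sum_fset_cst.
have -> : h *+ #|` E| = (#|` E|%:R : R[i]) *: h by rewrite scaler_nat.
by rewrite scalerA mulVf ?scale1r // pnatr_eq0 cardfs_eq0.
Qed.

Lemma avg_exchange E B (u : G -> G -> H) :
  avg E (fun x => avg B (u^~ x)) = avg B (fun b => avg E (u b)).
Proof.
rewrite /avg -!scaler_sumr !scalerA mulrC; congr (_ *: _).
exact: exchange_big.
Qed.

Lemma natV_complex n : n%:R^-1 = (n%:R^-1 : R)%:C%C.
Proof. by rewrite fmorphV rmorph_nat. Qed.

Lemma rnormV_nat n (h : H) : rnorm (n%:R^-1 *: h) = n%:R^-1 * rnorm h.
Proof. by rewrite natV_complex rnormZ ger0_norm ?invr_ge0. Qed.

Lemma rnorm_sum_le E u C : (forall x, x \in E -> rnorm (u x) <= C) ->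
  rnorm (\sum_(x <- E) u x) <= C * #|` E|%:R.
Proof. by move=> uC; exact: le_trans (ler_rnorm_sum _ _) (sum_fset_le uC). Qed.

Lemma rnorm_avg_le E u C : 0 <= C ->
  (forall x, x \in E -> rnorm (u x) <= C) -> rnorm (avg E u) <= C.
Proof.
move=> C0 uC; rewrite rnormV_nat.
have [->|E0] := eqVneq E fset0; first by rewrite cardfs0 invr0 mul0r.
rewrite mulrC ler_pdivrMr ?ltr0n ?cardfs_gt0 //.
exact: rnorm_sum_le.
Qed.

Lemma sum_fset_diff (A B : {fset G}) u :
  \sum_(x <- A) u x - \sum_(x <- B) u x =
  \sum_(x <- (A `\` B)%fset) u x - \sum_(x <- (B `\` A)%fset) u x.
Proof.
have sumID (S T : {fset G}) : \sum_(x <- S) u x =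
    \sum_(x <- (S `&` T)%fset) u x + \sum_(x <- (S `\` T)%fset) u x.
  rewrite (big_fsetID _ (mem T)) /=; congr (_ + _).
    by apply: eq_fbigl => x; rewrite !inE.
  by apply: eq_fbigl => x; rewrite !inE andbC.
by rewrite (sumID A B) (sumID B A) fsetIC opprD addrACA subrr add0r.
Qed.

Variable dot : {dot H for Num.conj}.

Lemma mean_rdot E u k :
  mean E (fun x => rdot dot (u x) k) = rdot dot (avg E u) k.
Proof. by rewrite /avg natV_complex rdotZl rdot_suml. Qed.

Hypothesis dot_norm : hilbert_dot dot.

(** The difference of the two sides is the variance of [u] on [E]. *)
Lemma rnorm_avg_sqr E u : E != fset0 ->
  rnorm (avg E u) ^+ 2 <= mean E (fun x => rnorm (u x) ^+ 2).
Proof.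
move=> E0; set m := avg E u.
have n0 : #|` E|%:R != 0 :> R by rewrite pnatr_eq0 cardfs_eq0.
have : 0 <= mean E (fun x => rnorm (u x - m) ^+ 2).
  by rewrite mulr_ge0 ?invr_ge0 // sumr_ge0 // => x _; exact: sqr_ge0.
have -> : mean E (fun x => rnorm (u x - m) ^+ 2) =
    mean E (fun x => rnorm (u x) ^+ 2) - rnorm m ^+ 2.
  rewrite /mean; under eq_bigr do rewrite (rnormB_sqr dot_norm).
  rewrite !big_split /= sumrN -mulr_sumr -rdot_suml.
  have -> : \sum_(x <- E) u x = (#|` E|%:R : R)%:C%C *: m.
    by rewrite rmorph_nat scalerA mulfV ?scale1r // pnatr_eq0 cardfs_eq0.
  rewrite rdotZl -(rnorm_sqr dot_norm) sum_fset_cst -mulr_natl; field.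
  exact: n0.
by rewrite subr_ge0.
Qed.

Lemma mean_rnorm_avg_sqr E B (u : G -> G -> H) :
  mean E (fun x => rnorm (avg B (u^~ x)) ^+ 2) =
  #|` B|%:R^-1 ^+ 2 *
    \sum_(b <- B) \sum_(b' <- B) mean E (fun x => rdot dot (u b x) (u b' x)).
Proof.
rewrite /mean; under eq_bigr do
  rewrite rnormV_nat exprMn (rnorm_sqr dot_norm) rdot_suml.
rewrite -mulr_sumr mulrCA; congr (_ * _).
rewrite exchange_big mulr_sumr; apply: eq_bigr => b _ /=.
under eq_bigr do rewrite rdot_sumr.
by rewrite exchange_big mulr_sumr.
Qed.
End Averages.

Lemma cvg0_sum (K : numFieldType) (V : normedModType K) (I : eqType) (s : seq I)
    (f : I -> nat -> V) : (forall i, i \in s -> f i @ \oo --> (0 : V)) ->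
  (fun N => \sum_(i <- s) f i N) @ \oo --> (0 : V).
Proof.
elim: s => [|i s IHs] f0.
  by apply: cvg_near_cst; apply: nearW => N; rewrite big_nil.
have -> : (fun N => \sum_(j <- i :: s) f j N) =
    (fun N => f i N + \sum_(j <- s) f j N).
  by apply/funext => N; rewrite big_cons.
rewrite -[X in _ --> X]addr0; apply: cvgD.
  by apply: f0; rewrite mem_head.
by apply: IHs => j js; apply: f0; rewrite in_cons js orbT.
Qed.

(** * The mean ergodic theorem and van der Corput's argument *)

Section Folner.
Context {R : realType} {H : completeNormedModType R[i]} {G : choiceType}.
Variables (D : set G) (op : G -> G -> G) (F : nat -> {fset G}).
Hypothesis op_closed : forall g x, D g -> D x -> D (op g x).
Hypothesis op_inj : forall g, D g -> injective (op g).
Hypothesis F_folner : folner R D op F.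
Hypothesis F_neq0 : forall N, F N != fset0.
Hypothesis F_sub : forall N x, x \in F N -> D x.

(** Only the points of the symmetric difference of [g F_N] and [F_N] contribute
    to the difference of the two sums, and their proportion tends to 0. *)
Lemma folner_shift (u : G -> H) C g : D g ->
  (forall x, D x -> rnorm (u x) <= C) ->
  (fun N => rnorm (avg (F N) (fun x => u (op g x)) - avg (F N) u)) @ \oo -->
    (0 : R).
Proof.
move=> Dg uC.
pose r N : R := #|` ([fset op g z | z in F N] `&` F N)%fset|%:R / #|` F N|%:R.
have r_cvg : (fun N => 2 * C * (1 - r N)) @ \oo --> (0 : R).
  rewrite (_ : 0 = 2 * C * (1 - 1)); last by rewrite subrr mulr0.
  apply: cvgM; first exact: cvg_cst.
  by apply: cvgB; [exact: cvg_cst|exact: F_folner].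
apply: squeeze_cvgr (cvg_cst 0) r_cvg; apply: nearW => N.
rewrite rnorm_ge0 /=; set E := F N; set gE := [fset op g z | z in E]%fset.
have gE_card : #|` gE| = #|` E| by rewrite card_imfset //; exact: op_inj.
have E0 : 0 < #|` E|%:R :> R by rewrite ltr0n cardfs_gt0 F_neq0.
have -> : avg E (fun x => u (op g x)) - avg E u = #|` E|%:R^-1 *:
    (\sum_(x <- (gE `\` E)%fset) u x - \sum_(x <- (E `\` gE)%fset) u x).
  rewrite -sum_fset_diff scalerBr; congr (_ *: _ - _).
  by rewrite big_imfset //= => x y _ _; exact: op_inj.
rewrite rnormV_nat mulrC ler_pdivrMr // -!mulrA mulrBl mul1r divfK ?gt_eqF //.
apply: le_trans (ler_rnormB _ _) _.
have gE_D x : x \in gE -> D x.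
  by move=> /imfsetP[y /= Ey ->]; apply: op_closed => //; exact: F_sub Ey.
have SB (A B : {fset G}) : (forall x, x \in A -> D x) ->
    rnorm (\sum_(x <- (A `\` B)%fset) u x) <= C * #|` (A `\` B)%fset|%:R.
  by move=> AD; apply: rnorm_sum_le => x /fsetDP[/AD Dx _]; exact: uC.
have := SB gE E gE_D; have := SB E gE (@F_sub N).
have := congr1 (fun n => n%:R : R) (cardfsID E gE).
have := congr1 (fun n => n%:R : R) (cardfsID gE E).
rewrite gE_card fsetIC !natrD.
set k := #|` (gE `&` E)%fset|%:R; set n := #|` E|%:R.
set a := #|` (E `\` gE)%fset|%:R; set b := #|` (gE `\` E)%fset|%:R.
move=> ka kb.
have -> : a = n - k by lra.
have -> : b = n - k by lra.
lra.
Qed.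

Variable dot : {dot H for Num.conj}.
Hypothesis dot_norm : hilbert_dot dot.

Section MeanErgodic.
Variable U : G -> {linear H -> H}.
Hypothesis U_rep : unitary_representation dot D op U.
Hypothesis opC : commutative op.

Definition null_average : set H :=
  [set h | (fun N => avg (F N) (U ^~ h)) @ \oo --> (0 : H)].

Lemma null_average_subspace : subspace null_average.
Proof.
split=> [|a u v u0 v0]; rewrite /null_average /=.
  apply: cvg_near_cst; apply: nearW => N.
  by rewrite /avg big1 ?scaler0 // => x _; rewrite linear0.
rewrite -(addr0 (0 : H)) -{1}(scaler0 _ a).
rewrite (_ : (fun N => _) =
    fun N => a *: avg (F N) (U ^~ u) + avg (F N) (U ^~ v)).
  by apply: cvgD => //; apply: cvgZ => //; exact: cvg_cst.
apply/funext => N; rewrite -avgZ -avgD; apply: eq_avg => x _.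
by rewrite linearP.
Qed.

Lemma null_average_closed : closed null_average.
Proof.
apply: closed_rnorm => h h_approx; apply/cvg0_rnormP/cvgrPdist_lt => e e0.
have e2 : 0 < e / 2 by rewrite divr_gt0.
have [v /cvg0_rnormP/cvgrPdist_lt v0 hv] := h_approx _ e2.
apply: filterS (v0 _ e2) => N; rewrite !sub0r !normrN.
rewrite !ger0_norm ?rnorm_ge0 // => vN.
rewrite -[avg _ _](subrK (avg (F N) (U ^~ v))) -avgB.
apply: le_lt_trans (ler_rnormD _ _) _; rewrite (splitr e).
apply: ler_ltD => //; apply: rnorm_avg_le; first exact: ltW.
move=> x /F_sub Dx; rewrite -linearB (unitary_rnorm dot_norm _ (U_rep.1 _ Dx)).
exact: ltW.
Qed.

(** The average of the orbit of [U g h] is that of the orbit of [h], shifted. *)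
Lemma null_average_coboundary g h : D g -> null_average (U g h - h).
Proof.
move=> Dg; apply/cvg0_rnormP.
have := folner_shift (u := U ^~ h) (C := rnorm h) Dg.
rewrite (_ : (fun N => rnorm (avg (F N) (U ^~ (U g h - h)))) =
  (fun N => rnorm (avg (F N) (fun x => U (op g x) h) - avg (F N) (U ^~ h)))).
  by apply=> x Dx; rewrite (unitary_rnorm dot_norm _ (U_rep.1 _ Dx)).
apply/funext => N; rewrite -avgB; congr rnorm; apply: eq_avg => x /F_sub Dx.
by rewrite linearB opC (U_rep.2).
Qed.

(** The component [d] of [h] orthogonal to [null_average] satisfies
    <d, U g d> = |d|^2, hence U g d = d. Since [h] and [h - d] are both
    orthogonal to [d], it vanishes. *)
Lemma mean_ergodic h : (forall v, fixed_space D U v -> dot h v = 0) ->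
  (fun N => avg (F N) (U ^~ h)) @ \oo --> (0 : H).
Proof.
move=> h_orth; have [P PP] := orthogonal_projection_exists dot_norm
  null_average_closed null_average_subspace.
have [Ph_null hP] := PP h; set d := h - P h in hP.
have d_fixed : fixed_space D U d.
  move=> g Dg; apply/eqP; rewrite -subr_eq0; apply/eqP/rnorm_eq0/eqP.
  have := hP _ (null_average_coboundary d Dg).
  move=> /(congr1 (@complex.Re _)); rewrite -/(rdot dot d (U g d - d)) /=.
  rewrite rdotDr rdotNr -(rnorm_sqr dot_norm) => /eqP.
  rewrite subr_eq0 => /eqP dUd.
  rewrite -sqrf_eq0 (rnormB_sqr dot_norm) (rdotC _ (U g d)) dUd.
  by rewrite (unitary_rnorm dot_norm _ (U_rep.1 _ Dg)); apply/eqP; ring.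
suff d0 : d = 0 by move/eqP: d0; rewrite subr_eq0 => /eqP ->.
apply/eqP; rewrite -(dnorm_eq0 dot) {1}/d linearBl /= h_orth // sub0r oppr_eq0.
by rewrite herm_eq0C; apply/eqP/hP.
Qed.
End MeanErgodic.

(** By [folner_shift] the average of [u] is close to that of
    w(x) = 1/|B| \sum_(b in B) u(bx). The squared norm of the latter is at most
    the mean of |w(x)|^2, a sum of correlations divided by |B|^2, in which the
    diagonal accounts for at most C^2/|B| and the rest tends to 0. *)
Lemma van_der_corput (u : G -> H) C :
  (forall x, D x -> rnorm (u x) <= C) ->
  (forall n, exists B : {fset G}, [/\ (n <= #|` B|)%N,
    forall b, b \in B -> D b &
    forall b b', b \in B -> b' \in B -> b != b' ->
      (fun N => mean (F N) (fun x => rdot dot (u (op b x)) (u (op b' x))))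
        @ \oo --> (0 : R)]) ->
  (fun N => avg (F N) u) @ \oo --> (0 : H).
Proof.
move=> uC u_corr; apply/cvg0_rnormP/cvgrPdist_lt => e e0.
have C2 : 0 <= C ^+ 2 by exact: sqr_ge0.
have d0 : 0 < (e / 2) ^+ 2 / 2 by rewrite divr_gt0 ?exprn_gt0 ?divr_gt0.
have dC : 0 < (e / 2) ^+ 2 / 2 / (C ^+ 2 + 1).
  by rewrite divr_gt0 // ltr_wpDl.
have [n nC] := filter_ex (near_infty_natSinv_lt (PosNum dC)).
have [B [nB BD B_corr]] := u_corr n.+1.
have B0 : B != fset0 by rewrite -cardfs_gt0 (leq_trans _ nB).
have Bpos : 0 < #|` B|%:R :> R by rewrite ltr0n cardfs_gt0.
pose corr N b b' := mean (F N) (fun x => rdot dot (u (op b x)) (u (op b' x))).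
pose off N := #|` B|%:R^-1 ^+ 2 *
  \sum_(b <- B) \sum_(b' <- B | b' != b) corr N b b'.
have off0 : off @ \oo --> (0 : R).
  rewrite -[X in _ --> X](mulr0 (#|` B|%:R^-1 ^+ 2)).
  apply: cvgM; first exact: cvg_cst.
  apply: (@cvg0_sum _ R^o) => b Bb.
  rewrite (_ : (fun N => _) = fun N =>
      \sum_(b' <- [seq b' <- B | b' != b]) corr N b b'); last first.
    by apply/funext => N; rewrite big_filter.
  apply: (@cvg0_sum _ R^o) => b'; rewrite mem_filter => /andP[b'b Bb'].
  by apply: B_corr; rewrite // eq_sym.
have shift0 : (fun N => avg B (fun b =>
    avg (F N) (fun x => u (op b x)) - avg (F N) u)) @ \oo --> (0 : H).
  rewrite -[X in _ --> X](scaler0 _ (#|` B|%:R^-1)).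
  apply: cvgZ; first exact: cvg_cst.
  apply: cvg0_sum => b Bb; apply/cvg0_rnormP.
  exact: folner_shift (BD _ Bb) uC.
move/cvg0_rnormP/cvgrPdist_lt: shift0 => shift0.
move/cvgrPdist_lt: off0 => off0.
have e2 : 0 < e / 2 by rewrite divr_gt0.
apply: filterS (filterI (shift0 _ e2) (off0 _ d0)) => N [].
rewrite !sub0r !normrN !(ger0_norm (rnorm_ge0 _)) => sN oN.
pose w x := avg B (fun b => u (op b x)).
have w_small : rnorm (avg (F N) w) < e / 2.
  rewrite -(ltr_pXn2r (n := 2)) ?nnegrE ?rnorm_ge0 ?(ltW e2) //.
  apply: le_lt_trans (rnorm_avg_sqr dot_norm _ (F_neq0 N)) _.
  rewrite (mean_rnorm_avg_sqr dot_norm _ _ (fun b x => u (op b x))).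
  have -> : \sum_(b <- B) \sum_(b' <- B) corr N b b' =
     \sum_(b <- B) corr N b b +
     \sum_(b <- B) \sum_(b' <- B | b' != b) corr N b b'.
    rewrite -big_split; rewrite !big_seq; apply: eq_bigr => b Bb /=.
    by rewrite (bigD1_seq b) ?fset_uniq.
  rewrite mulrDr -/(off N).
  have diag : \sum_(b <- B) corr N b b <= C ^+ 2 * #|` B|%:R.
    apply: sum_fset_le => b Bb; apply: mean_le => // x /F_sub Dx.
    have ux := uC _ (op_closed (BD _ Bb) Dx).
    rewrite -(rnorm_sqr dot_norm) lerXn2r ?nnegrE ?rnorm_ge0 //.
    exact: le_trans (rnorm_ge0 _) ux.
  have : #|` B|%:R^-1 ^+ 2 * \sum_(b <- B) corr N b b < (e / 2) ^+ 2 / 2.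
    apply: le_lt_trans (ler_wpM2l _ diag) _; first by rewrite sqr_ge0.
    have -> : #|` B|%:R^-1 ^+ 2 * (C ^+ 2 * #|` B|%:R) = #|` B|%:R^-1 * C ^+ 2.
      by field; rewrite gt_eqF.
    have i0 : 0 < #|` B|%:R^-1 :> R by rewrite invr_gt0.
    have : #|` B|%:R^-1 < (e / 2) ^+ 2 / 2 / (C ^+ 2 + 1).
      apply: le_lt_trans nC.
      by rewrite lef_pV2 ?posrE ?ltr0n ?ler_nat ?cardfs_gt0.
    rewrite ltr_pdivlMr ?ltr_wpDl // mulrDr mulr1.
    by apply: lt_trans; rewrite ltrDl.
  have := ler_norm (off N); lra.
rewrite -[avg _ u](subrK (avg (F N) w)) (splitr e).
apply: le_lt_trans (ler_rnormD _ _) _; apply: ltrD w_small.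
rewrite -rnormN opprB.
rewrite (avg_exchange _ _ (fun b x => u (op b x))) -[avg _ u](avg_cst _ B0).
by rewrite -avgB.
Qed.
End Folner.

(** * Representations linked by the distributivity law *)

(** Each new element avoids 0 and the elements already chosen, up to sign. *)
Lemma infinite_field_distinct_squares (K : fieldType) (n : nat) :
  infinite_set [set: K] -> exists B : {fset K}, [/\ (n <= #|` B|)%N,
    forall b, b \in B -> b != 0 &
    forall b b', b \in B -> b' \in B -> b != b' -> b ^+ 2 != b' ^+ 2].
Proof.
move=> K_infinite; elim: n => [|n [B [nB B0 B_sqr]]]; first by exists fset0.
pose S := (0 |` (B `|` [fset - b | b in B]))%fset.
have [c [_ /negP]] := infinite_setN0 (infinite_setD K_infinite (finite_fset S)).
rewrite !inE !negb_or => /and3P[c0 cB cNB].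
have c_sqr b : b \in B -> c ^+ 2 != b ^+ 2.
  move=> Bb; rewrite eqf_sqr negb_or; apply/andP; split.
    by apply: contra cB => /eqP ->.
  by apply: contra cNB => /eqP ->; apply/imfsetP; exists b.
exists (c |` B)%fset; split.
- by rewrite cardfsU1 cB.
- by move=> b; rewrite !inE => /orP[/eqP->|/B0].
move=> b b'; rewrite !inE => /orP[/eqP->|Bb] /orP[/eqP->|Bb'] bb'.
- by rewrite eqxx in bb'.
- exact: c_sqr.
- by rewrite eq_sym c_sqr.
- exact: B_sqr.
Qed.

Section DistributiveRepresentations.
Context {R : realType} {K : fieldType} {H : completeNormedModType R[i]}.
Variable dot : {dot H for Num.conj}.
Hypothesis dot_norm : hilbert_dot dot.
Variables A M : K -> {linear H -> H}.
Hypothesis A_rep : unitary_representation dot [set: K] +%R A.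
Hypothesis M_rep : unitary_representation dot [set y : K | y != 0] *%R M.
Hypothesis distr : forall x y : K, y != 0 ->
  forall h : H, M y (A x h) = A (x * y) (M y h).

Let VA := fixed_space [set: K] A.
Let VM := fixed_space [set y : K | y != 0] M.

Lemma mul_rep1 h : M 1 h = h.
Proof.
have [/bij_inj M1_inj _] := M_rep.1 1 (oner_neq0 K).
by apply: M1_inj; rewrite -(M_rep.2 1 1 (oner_neq0 K) (oner_neq0 K)) mulr1.
Qed.

Lemma mul_repVK y h : y != 0 -> M y (M y^-1 h) = h.
Proof.
move=> y0; rewrite -(M_rep.2 y y^-1 y0) /= ?invr_neq0 //.
by rewrite mulfV // mul_rep1.
Qed.

Lemma mul_rep_fixed y v : y != 0 -> VA v -> VA (M y v).
Proof.
move=> y0 Av x _; rewrite -[x](divfK y0) -distr //.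
by rewrite Av.
Qed.

(** [M y] is unitary and maps [VA] onto itself, so it also preserves the
    orthogonal complement. *)
Lemma mul_rep_orthogonal y h : y != 0 -> (forall v, VA v -> dot h v = 0) ->
  forall v, VA v -> dot (M y h) v = 0.
Proof.
move=> y0 h_orth v Av; rewrite -(mul_repVK v y0).
have [_ ->] := M_rep.1 y y0.
by apply: h_orth; apply: mul_rep_fixed; rewrite // invr_neq0.
Qed.

(** For [h] fixed by [M z], the vector [M z (P h)] has the two properties that
    characterise the projection of [h] on [VA]. *)
Lemma projection_fixed (P : {linear H -> H}) h :
  orthogonal_projection dot VA P -> VM h -> VM (P h).
Proof.
move=> PP Mh z z0; have [APh hP] := PP h.
apply: (projection_unique (fixed_space_subspace _ _) (h := h) _ APh _ hP).
  exact: mul_rep_fixed.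
by rewrite -{1}[h](Mh z z0) -linearB; exact: mul_rep_orthogonal.
Qed.

(** Cancel [M x], move [M b] and [M b'] to the right of the additive operators,
    then cancel the common factor [A (b'^2 x)]. *)
Lemma orbit_correlation f b b' x : b != 0 -> b' != 0 -> x != 0 ->
  rdot dot (M (b * x) (A (b * x) f)) (M (b' * x) (A (b' * x) f)) =
  rdot dot (A (x * (b ^+ 2 - b' ^+ 2)) (M b f)) (M b' f).
Proof.
move=> b0 b0' x0; rewrite (mulrC b) (mulrC b').
rewrite !(M_rep.2 x) // (unitary_rdot _ _ (M_rep.1 x x0)) !distr //.
have -> : x * b * b = x * b' * b' + x * (b ^+ 2 - b' ^+ 2) by ring.
by rewrite (A_rep.2 _ _ I I) (unitary_rdot _ _ (A_rep.1 _ I)).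
Qed.

Variable F : nat -> {fset K}.
Hypothesis F_folner : double_folner R F.

Lemma dilated_mean_ergodic c h : c != 0 -> (forall v, VA v -> dot h v = 0) ->
  (fun N => avg (F N) (fun x => A (x * c) h)) @ \oo --> (0 : H).
Proof.
move=> c0 h_orth; have [F_neq0 _ F_add _] := F_folner.
apply: (mean_ergodic (D := [set: K]) (op := +%R) _ _ F_add F_neq0 _ dot_norm
  (U := fun x => A (x * c))) => //.
- split=> [g _|g g' _ _ v]; first exact: A_rep.1.
  by rewrite mulrDl (A_rep.2 _ _ I I).
- exact: addrC.
by move=> v cv; apply: h_orth => x _; rewrite -[x](divfK c0); exact: cv.
Qed.

Lemma orbit_average_null f : infinite_set [set: K] ->
  (forall v, VA v -> dot f v = 0) ->
  (fun N => avg (F N) (fun x => M x (A x f))) @ \oo --> (0 : H).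
Proof.
move=> K_infinite f_orth; have [F_neq0 F_nz _ F_mul] := F_folner.
have F_sub N x : x \in F N -> x != 0 by apply: contraTneq => ->; exact: F_nz.
apply: (van_der_corput (D := [set y : K | y != 0]) (op := *%R) _ _ F_mul F_neq0
  F_sub dot_norm (C := rnorm f)) => //.
- by move=> g x /= g0 x0; rewrite mulf_neq0.
- by move=> g; exact: mulfI.
- move=> x x0; rewrite (unitary_rnorm dot_norm _ (M_rep.1 x x0)).
  by rewrite (unitary_rnorm dot_norm _ (A_rep.1 x I)).
move=> n.
have [B [nB B0 B_sqr]] := infinite_field_distinct_squares n K_infinite.
exists B; split=> // b b' Bb Bb' bb'.
have c0 : b ^+ 2 - b' ^+ 2 != 0 by rewrite subr_eq0 B_sqr.
rewrite (_ : (fun N => _) = fun N => rdot dot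
    (avg (F N) (fun x => A (x * (b ^+ 2 - b' ^+ 2)) (M b f))) (M b' f)).
  apply: (cvg0_rdot dot_norm); apply: dilated_mean_ergodic => //.
  by apply: mul_rep_orthogonal => //; exact: B0.
apply/funext => N; rewrite -mean_rdot; congr (_ * _).
apply: eq_big_seq => x /F_sub x0.
by apply: orbit_correlation => //; exact: B0.
Qed.
End DistributiveRepresentations.

Theorem theorem5p6 (R : realType) (K : fieldType)
    (K_countable : countable [set: K]) (K_infinite : infinite_set [set: K])
    (H : completeNormedModType R[i]) (dot : {dot H for Num.conj})
    (H_hilbert : hilbert_dot dot)
    (A M : K -> {linear H -> H})
    (A_rep : unitary_representation dot [set: K] +%R A)
    (M_rep : unitary_representation dot [set y : K | y != 0] *%R M)
    (distr : forall x y : K, y != 0 ->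
       forall h : H, M y (A x h) = A (x * y) (M y h)) :
  exists P : {linear H -> H},
    orthogonal_projection dot (invariant_subspace A M) P /\
    forall F : nat -> {fset K}, double_folner R F -> forall f : H,
      (#|` F N|%:R^-1 *: \sum_(x <- F N) M x (A x f)) @[N --> \oo] --> P f.
Proof.
pose VA := fixed_space [set: K] A.
pose VM := fixed_space [set y : K | y != 0] M.
have VA_sub : subspace VA by exact: fixed_space_subspace.
have VM_sub : subspace VM by exact: fixed_space_subspace.
have VA_closed : closed VA.
  by apply: (fixed_space_closed H_hilbert) => g; exact: A_rep.1.
have VM_closed : closed VM.
  by apply: (fixed_space_closed H_hilbert) => g; exact: M_rep.1.
have VE : invariant_subspace A M = VA `&` VM.
  apply/seteqP; split=> [h inv|h [Ah Mh] x y y0].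
    split=> [x _|y y0]; first by have [] := inv x 1 (oner_neq0 K).
    by have [] := inv 0 y y0.
  by split; [exact: Ah|exact: Mh].
have [PA PAP] := orthogonal_projection_exists H_hilbert VA_closed VA_sub.
have [P PP] : exists P : {linear H -> H},
    orthogonal_projection dot (invariant_subspace A M) P.
  apply: orthogonal_projection_exists => //; rewrite VE; first exact: closedI.
  split=> [|a u v [Au Mu] [Av Mv]].
    by split; [exact: VA_sub.1|exact: VM_sub.1].
  by split; [exact: VA_sub.2|exact: VM_sub.2].
exists P; split=> // F F_folner f.
have [F_neq0 F_nz _ F_mul] := F_folner.
have F_sub N x : x \in F N -> x != 0 by apply: contraTneq => ->; exact: F_nz.
rewrite VE in PP; have [[APf MPf] fP] := PP f; have [AQf fQ] := PAP f.
pose k := PA f - P f.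
(* k lies in VA, so v may be replaced by its projection PA v, which is fixed by
   both representations; against it both f - P f and f - PA f vanish *)
have k_orth v : VM v -> dot k v = 0.
  move=> Mv; have [AQv vQ] := PAP v.
  rewrite -[v](subrK (PA v)) linearDr /=.
  have -> : dot k (v - PA v) = 0.
    apply/eqP; rewrite herm_eq0C; apply/eqP/vQ.
    exact: subspaceB AQf APf.
  rewrite add0r (_ : k = (f - P f) - (f - PA f)); last first.
    by rewrite opprB addrC subrKA.
  rewrite linearBl /= fQ // fP ?subr0 //; split=> //.
  exact: (projection_fixed M_rep distr PAP Mv).
rewrite (_ : (fun N => _) = fun N =>
    avg (F N) (fun x => M x (A x (f - PA f))) + (avg (F N) (M ^~ k) + P f)); last first.
  apply/funext => N; rewrite -[_ *: _]/(avg (F N) (fun x => M x (A x f))).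
  rewrite -(avg_cst (P f) (F_neq0 N)) -!avgD; apply: eq_avg => x /F_sub x0.
  have -> : M x k + P f = M x (A x (PA f)).
    by rewrite (AQf x I) linearB (MPf x x0) subrK.
  by rewrite -!linearD subrK.
rewrite -[X in _ --> X]add0r; apply: cvgD.
  by apply: (orbit_average_null H_hilbert A_rep M_rep distr).
rewrite -[X in _ --> X]add0r; apply: cvgD; last exact: cvg_cst.
apply: (mean_ergodic (D := [set y : K | y != 0]) (op := *%R) _ _ F_mul F_neq0 _
  H_hilbert) => //.
- by move=> g x /= g0 x0; rewrite mulf_neq0.
- by move=> g; exact: mulfI.
- exact: mulrC.
Qed.
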